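(* Let $n \geq 1$ and let $\varepsilon\colon x_1 \cdots x_n \approx \rho(x_1, \dots, x_n)$ be a nontrivial $n$-ary product identity. Then at least one of the following two statements holds. (1) There exist indices $1 \leq i \leq j \leq n$ such that $\varepsilon \models x_1 \cdots x_n \approx x_1 \cdots x_{i-1} (x_i \cdots x_j)^{\omega + 1} x_{j+1} \cdots x_n$. (2) There exists a nontrivial permutation $\sigma \in \mathfrak{S}_n$ such that $\varepsilon \models x_1 \cdots x_n \approx x_{1\sigma} \cdots x_{n\sigma}$. In particular, every finite semigroup or pseudovariety satisfying the identity $\varepsilon$ is either almost completely regular, or permutative, or both.
   Context: A profinite word over a finite alphabet $A$ is an element of the profinite completion of the free semigroup $A^+$. An identity (pseudoidentity) is a pair $\rho_1 \approx \rho_2$ of nonempty profinite words over a finite alphabet of variables; it is nontrivial if $\rho_1 \neq \rho_2$. A finite semigroup $S$ satisfies the identity if $\rho_1$ and $\rho_2$ have the same image under every continuous homomorphism to $S$. A pseudovariety is a class of finite semigroups closed under finite direct products, subsemigroups and homomorphic images; it satisfies an identity if all its members do. For identities, $\varepsilon \models \varepsilon'$ means that every finite semigroup satisfying $\varepsilon$ also satisfies $\varepsilon'$. An $n$-ary product identity is an identity of the form $x_1 \cdots x_n \approx \rho(x_1,\dots,x_n)$, where $x_1,\dots,x_n$ are distinct variables and $\rho$ is a nonempty profinite word in $x_1,\dots,x_n$ (not all of which need to occur in $\rho$). For an element $s$ of a finite semigroup, $s^\omega$ denotes the unique idempotent power of $s$ and $s^{\omega+1} = s^\omega s$; $x^{\omega+1}$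 denotes the corresponding profinite operation. $\mathfrak{S}_n$ is the symmetric group on $\{1,\dots,n\}$, acting on the right ($i\sigma$ is the image of $i$). A finite semigroup or pseudovariety is almost completely regular if it satisfies $x_1 \cdots x_m \approx x_1 \cdots x_{i-1} (x_i \cdots x_j)^{\omega + 1} x_{j+1} \cdots x_m$ for some $m \geq 1$ and $1 \leq i \leq j \leq m$. It is permutative if it satisfies $x_1 \cdots x_m \approx x_{1\sigma} \cdots x_{m\sigma}$ for some $m$ and some nontrivial permutation $\sigma \in \mathfrak{S}_m$ (for a pseudovariety, a single such identity must be satisfied by all members). *)

(* Defs.v *)
From HB Require Import structures.
From mathcomp Require Import all_boot perm.
From mathcomp Require Import all_classical topology.

Set Implicit Arguments.
Unset Strict Implicit.
Unset Printing Implicit Defensive.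

Local Open Scope classical_set_scope.
Local Open Scope group_scope.
Local Open Scope quotient_scope.

Section FreeSemigroup.
Variable A : choiceType.

Definition word := {w : seq A | w != [::]}.
HB.instance Definition _ := Choice.on word.

Fact word_mul_subproof (u v : word) : val u ++ val v != [::].
Proof. by case: u => -[]. Qed.

Definition word_mul (u v : word) : word := exist _ (val u ++ val v) (word_mul_subproof u v).

Fact word_mulA : associative word_mul.
Proof. by move=> u v w; apply: val_inj; rewrite /= catA. Qed.

HB.instance Definition _ := isSemigroup.Build word word_mulA.

Definition letter (a : A) : word := exist _ [:: a] isT.

End FreeSemigroup.

Section Omega.
Variable G : semigroupType.
Implicit Types x e : G.

(* [spow x k] is x^(k+1). *)
Definition spow x (k : nat) : G := iter k (mul x) x.

Definition idempotent_power x e : Prop := e * e = e /\ exists k, e = spow x k.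

(* Meaningful when x has an idempotent power, e.g. when G is finite;
   the idempotent power is then unique. *)
Definition omega x : G := xget x [set e | idempotent_power x e].

Lemma spowD x j k : spow x j * spow x k = spow x (j + k).+1.
Proof. by elim: j => [|j IH] //=; rewrite -mulgA IH. Qed.

Lemma spowM x j k : spow (spow x j) k = spow x (j.+1 * k.+1).-1.
Proof.
elim: k => [|k IH]; first by rewrite muln1.
rewrite [LHS]/= -/(spow _ k) IH spowD; congr (spow x _).
by rewrite (mulnS j.+1 k.+1) addSn -addnS prednK ?muln_gt0.
Qed.

Lemma spow_idem e k : e * e = e -> spow e k = e.
Proof. by move=> ee; elim: k => //= k ->. Qed.

Lemma idempotent_power_uniq x e f :
  idempotent_power x e -> idempotent_power x f -> e = f.
Proof.
move=> [ee [j ej]] [ff [k fk]].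
by rewrite -(spow_idem k ee) -(spow_idem j ff) {1}ej {1}fk !spowM mulnC.
Qed.

Lemma idempotent_power_exists x :
  finite_set [set: G] -> exists e, idempotent_power x e.
Proof.
move=> finG.
have [i [p xip]] : exists i p, spow x i = spow x (i + p.+1).
  apply: contrapT => noloop; have inj : injective (spow x).
    move=> j k; case: (ltngtP j k) => // ltjk eqjk; exfalso; apply: noloop.
      by exists j, (k - j).-1; rewrite prednK ?subn_gt0 // subnKC // ltnW.
    by exists k, (j - k).-1; rewrite prednK ?subn_gt0 // subnKC // ltnW.
  apply: infinite_nat; apply: sub_finite_set (finite_preimage _ finG).
    by move=> ? _.
  by move=> j k _ _; apply: inj.
have xmp m : (i <= m)%N -> spow x m = spow x (m + p.+1).
  move=> /subnK <-; case: (m - i)%N => [|d]; first by rewrite add0n.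
  by rewrite !addSn -spowD xip spowD addnA.
have xmpq m q : (i <= m)%N -> spow x (m + q * p.+1) = spow x m.
  move=> im; elim: q => [|q IH]; first by rewrite addn0.
  by rewrite mulSn addnCA addnC -xmp ?IH // (leq_trans im) ?leq_addr.
pose m := (i.+1 * p.+1).-1.
have mE : m.+1 = (i.+1 * p.+1)%N by [].
have im : (i <= m)%N by rewrite -ltnS mE leq_pmulr.
exists (spow x m); split; last by exists m.
by rewrite spowD -addnS mE xmpq.
Qed.

Lemma omegaP x : finite_set [set: G] -> idempotent_power x (omega x).
Proof. by move=> /(idempotent_power_exists x)[e ?]; apply: (@xgetI _ x _ e). Qed.

End Omega.

Section Profinite.
Variable G : semigroupType.

Record fcong := FCong {
  fcong_equiv :> equiv_rel G;
  fcongM : forall x x' y y', fcong_equiv x x' -> fcong_equiv y y' ->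
    fcong_equiv (x * y) (x' * y');
  fcong_finite : finite_set [set: {eq_quot fcong_equiv}] }.

(* The library's lemmas on product spaces ask for an index type with equality. *)
HB.instance Definition _ := gen_eqMixin fcong.
HB.instance Definition _ := gen_choiceMixin fcong.

Definition fquot (t : fcong) := {eq_quot t}.
HB.instance Definition _ (t : fcong) := EqQuotient.on (fquot t).
HB.instance Definition _ (t : fcong) := Choice.on (fquot t).

Section FQuot.
Variable t : fcong.

Definition fquot_mul (a b : fquot t) : fquot t :=
  \pi_(fquot t) (repr a * repr b).

Lemma pi_eq (x y : G) : t x y -> \pi_(fquot t) x = \pi_(fquot t) y.
Proof. by move=> txy; apply/(@eqquotP _ _ (fquot t)). Qed.

Lemma repr_pi (x : G) : t (repr (\pi_(fquot t) x)) x.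
Proof. by apply/(@eqquotP _ _ (fquot t)); rewrite reprK. Qed.

Lemma pi_fquot_mul (x y : G) :
  fquot_mul (\pi_(fquot t) x) (\pi_(fquot t) y) = \pi_(fquot t) (x * y).
Proof. by apply: pi_eq; apply: fcongM; apply: repr_pi. Qed.

Fact fquot_mulA : associative fquot_mul.
Proof.
move=> a b c; rewrite -[a]reprK -[b]reprK -[c]reprK.
move: (repr a) (repr b) (repr c) => x y z.
rewrite (pi_fquot_mul y) (pi_fquot_mul x (y * z)) (pi_fquot_mul x y).
by rewrite (pi_fquot_mul (x * y)) mulgA.
Qed.

HB.instance Definition _ := isSemigroup.Build (fquot t) fquot_mulA.
End FQuot.

(* Meaningful when t is contained in t'. *)
Definition fquot_proj (t t' : fcong) (a : fquot t) : fquot t' :=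
  \pi_(fquot t') (repr a).

(* The profinite completion is the inverse limit of the finite quotients of G,
   a subspace of the product of these quotients taken as discrete spaces. *)
Definition fquot_product := prod_topology (fun t => discrete_topology (fquot t)).

Definition coherent : set fquot_product :=
  [set x | forall t t' : fcong, subrel t t' -> x t' = fquot_proj t' (x t)].

Definition profinite := set_type coherent.
HB.instance Definition _ := Topological.on profinite.

Definition pcoord (x : profinite) (t : fcong) : fquot t := \val x t.

Lemma pcoord_coherent (x : profinite) (t t' : fcong) : subrel t t' ->
  pcoord x t' = fquot_proj t' (pcoord x t).
Proof. exact: (set_mem (valP x)). Qed.

Lemma fquot_projM (t t' : fcong) : subrel t t' ->
  {morph @fquot_proj t t' : a b / a * b}.
Proof.
move=> tt' a b; rewrite /fquot_proj [RHS](pi_fquot_mul t' (repr a) (repr b)).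
by apply: pi_eq; apply: tt'; apply: repr_pi.
Qed.

Fact pembed_subproof (x : G) :
  ((fun t => \pi_(fquot t) x) : fquot_product) \in coherent.
Proof.
apply/mem_set => t t' tt'.
by apply/esym/pi_eq; apply: tt'; apply: repr_pi.
Qed.

Definition pembed (x : G) : profinite :=
  @exist _ (fun z => z \in coherent) _ (pembed_subproof x).

Fact pmul_subproof (x y : profinite) :
  ((fun t => pcoord x t * pcoord y t) : fquot_product) \in coherent.
Proof.
apply/mem_set => t t' tt'.
by rewrite (pcoord_coherent x tt') (pcoord_coherent y tt') fquot_projM.
Qed.

Definition pmul (x y : profinite) : profinite :=
  @exist _ (fun z => z \in coherent) _ (pmul_subproof x y).

Lemma pcoord_inj (x y : profinite) : (forall t, pcoord x t = pcoord y t) -> x = y.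
Proof. by move=> xy; apply/val_inj/functional_extensionality_dep. Qed.

Fact pmulA : associative pmul.
Proof. by move=> x y z; apply: pcoord_inj => t; rewrite /pcoord /= mulgA. Qed.

HB.instance Definition _ := isSemigroup.Build profinite pmulA.

Lemma fquot_proj_omega (t t' : fcong) (a : fquot t) : subrel t t' ->
  omega (fquot_proj t' a) = fquot_proj t' (omega a).
Proof.
move=> tt'; apply: (@idempotent_power_uniq _ (fquot_proj t' a)).
  exact/omegaP/fcong_finite.
have [ee [k ek]] := omegaP a (@fcong_finite t).
split; first by rewrite -fquot_projM // ee.
exists k; rewrite ek; elim: k {ee ek} => //= k IH.
by rewrite fquot_projM // IH.
Qed.

Fact pomega_subproof (x : profinite) :
  ((fun t => omega (pcoord x t)) : fquot_product) \in coherent.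
Proof.
apply/mem_set => t t' tt'.
by rewrite (pcoord_coherent x tt') fquot_proj_omega.
Qed.

Definition pomega (x : profinite) : profinite :=
  @exist _ (fun z => z \in coherent) _ (pomega_subproof x).

Definition pomegaS (x : profinite) : profinite := pomega x * x.

End Profinite.

Definition profinite_word (A : finType) := profinite (word A).

Definition pletter (A : finType) (a : A) : profinite_word A := pembed (letter a).

Record pseudoidentity := PseudoIdentity {
  pid_alphabet : finType;
  pid_lhs : profinite_word pid_alphabet;
  pid_rhs : profinite_word pid_alphabet }.

(* Only used for a finite S, whose topology is discrete. *)
Definition satisfies (S : semigroupType) (e : pseudoidentity) : Prop :=
  forall f : {multiplicative profinite_word (pid_alphabet e) -> S},
    continuous (f : _ -> discrete_topology S) -> f (pid_lhs e) = f (pid_rhs e).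

Definition class_satisfies (V : semigroupType -> Prop) (e : pseudoidentity) :
  Prop := forall S, V S -> satisfies S e.

Definition entails (e e' : pseudoidentity) : Prop :=
  forall S : semigroupType, finite_set [set: S] ->
    satisfies S e -> satisfies S e'.

(* A possibly empty sequence acting on the left and on the right; needed since
   profinite words do not include the empty word. *)
Definition lmuls (G : semigroupType) (s : seq G) (x : G) : G := foldr mul x s.
Definition rmuls (G : semigroupType) (x : G) (s : seq G) : G := foldl mul x s.

(* Variables are indexed by 'I_n.+1, so that the arity n.+1 is at least 1. *)
Section ProductIdentities.
Variable n : nat.
Implicit Types (i j : 'I_n.+1) (s : 'S_n.+1).

Definition xvar i : profinite_word 'I_n.+1 := pletter i.

Definition xprod : profinite_word 'I_n.+1 :=
  rmuls (xvar ord0) [seq xvar k | k : 'I_n.+1 <- enum 'I_n.+1 & (0 < k)%N].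

Definition xperm s : profinite_word 'I_n.+1 :=
  rmuls (xvar (s ord0)) [seq xvar (s k) | k : 'I_n.+1 <- enum 'I_n.+1 & (0 < k)%N].

Definition xfactor i j : profinite_word 'I_n.+1 :=
  rmuls (xvar i) [seq xvar k | k : 'I_n.+1 <- enum 'I_n.+1 & (i < k <= j)%N].

Definition product_identity (rho : profinite_word 'I_n.+1) : pseudoidentity :=
  PseudoIdentity xprod rho.

Definition omega_identity i j : pseudoidentity :=
  product_identity
    (rmuls (lmuls [seq xvar k | k : 'I_n.+1 <- enum 'I_n.+1 & (k < i)%N]
                  (pomegaS (xfactor i j)))
           [seq xvar k | k : 'I_n.+1 <- enum 'I_n.+1 & (j < k)%N]).

Definition perm_identity s : pseudoidentity := product_identity (xperm s).

End ProductIdentities.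

Definition almost_completely_regular (S : semigroupType) : Prop :=
  exists (m : nat) (i j : 'I_m.+1),
    (i <= j)%N /\ satisfies S (omega_identity i j).

Definition permutative (S : semigroupType) : Prop :=
  exists (m : nat) (s : 'S_m.+1), s <> 1 /\ satisfies S (perm_identity s).

Definition class_almost_completely_regular (V : semigroupType -> Prop) :
  Prop := exists (m : nat) (i j : 'I_m.+1),
    (i <= j)%N /\ class_satisfies V (omega_identity i j).

Definition class_permutative (V : semigroupType -> Prop) : Prop :=
  exists (m : nat) (s : 'S_m.+1),
    s <> 1 /\ class_satisfies V (perm_identity s).

Section DirectProduct.
Variables (I : finType) (S : I -> semigroupType).

Definition direct_product := {dffun forall i : I, S i}.
HB.instance Definition _ := Choice.on direct_product.

Definition direct_product_mul (x y : direct_product) : direct_product :=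
  [ffun i => x i * y i].

Fact direct_product_mulA : associative direct_product_mul.
Proof. by move=> x y z; apply/ffunP => i; rewrite !ffunE mulgA. Qed.

HB.instance Definition _ := isSemigroup.Build direct_product direct_product_mulA.
End DirectProduct.

(* Subsemigroups are taken up to isomorphism and nonempty, so that the empty
   semigroup may but need not belong to a pseudovariety. *)
Record is_pseudovariety (V : semigroupType -> Prop) : Prop := {
  pseudovariety_finite : forall S, V S -> finite_set [set: S];
  pseudovariety_product : forall (I : finType) (S : I -> semigroupType),
    (forall i, V (S i)) -> V (direct_product S);
  pseudovariety_sub : forall (S T : semigroupType)
    (f : {multiplicative T -> S}), inhabited T -> injective f -> V S -> V T;
  pseudovariety_image : forall (S T : semigroupType)
    (f : {multiplicative S -> T}), (forall y, exists x, f x = y) -> V S -> V T }.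

(* Main.v *)
From HB Require Import structures.
Require Import Defs.
From mathcomp Require Import all_boot perm all_classical topology zify.

Set Implicit Arguments.
Unset Strict Implicit.
Unset Printing Implicit Defensive.

Local Open Scope group_scope.
Local Open Scope quotient_scope.

(* By compactness rho may be replaced by a finite word w over x_0, ..., x_(n-1),
   different from x_0 ... x_(n-1). If some x_k does not occur in w, the product
   does not depend on its k-th factor, which can be replaced by its
   (omega+1)-power. If all letters occur and w has length n, the identity is a
   permutation. Otherwise w is longer than n.
   If w = x_0 w' and x_0 does not occur in w', then x_1 ... x_(n-1) = w' holds
   in the quotient identifying u and v when a u = a v for all a; the same holds
   on the right. This reduces to the case where x_0 is not both first and
   unrepeated in w, and x_(n-1) not both last and unrepeated. Then every product
   p = s_0 ... s_(n-1) is a group element: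
   - p = u p for some u. If w starts with x_k, k > 0, then p has arbitrarily
     long factorizations, hence one into n factors whose k-th factor starts
     with an idempotent e, and the identity moves that factor to the front, so
     p = e p. If w = x_0 .. x_0 .., then p = z r implies p = z t z r', and
     finiteness gives some z = z t z m, whence z = u z. Dually p = p f.
   - A repeated letter of w, applied to p = u .. u p f .. f, puts p in
     S p S p S, so p is regular: p = p q p.
   - w has a factor x_k x_l with l <= k; applied to p = (pq) .. (pq) p (qp) ..
     (qp) it puts p in S p p S, hence p^(omega+1) = p. *)

(** * Powers, idempotent powers and finiteness *)

Section Powers.
Variable G : semigroupType.
Implicit Types x u v e : G.

Lemma spowSr x k : spow x k.+1 = spow x k * x.
Proof. by rewrite -[in RHS](erefl : spow x 0 = x) spowD addn0. Qed.

Lemma spow_sandwich x u v k : x = u * x * v -> x = spow u k * x * spow v k.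
Proof.
move=> xE; elim: k => [//|k IH].
by rewrite spowSr {1}IH {1}xE /= !mulgA.
Qed.

(** Iterating the equation writes [x] with powers of [u] in front; one of them is [e]. *)
Lemma idempotent_power_absorbl x u v e :
  idempotent_power u e -> x = u * x * v -> e * x = x.
Proof.
by move=> [ee [k eE]] /(spow_sandwich k) ->; rewrite -eE !mulgA ee.
Qed.

Lemma idempotent_power_absorbr x u v e :
  idempotent_power v e -> x = u * x * v -> x * e = x.
Proof.
by move=> [ee [k eE]] /(spow_sandwich k) ->; rewrite -eE -!mulgA ee.
Qed.

End Powers.

Lemma spow_morph (G H : semigroupType) (f : G -> H) x k :
  {morph f : y z / y * z} -> f (spow x k) = spow (f x) k.
Proof. by move=> fM; elim: k => //= k IH; rewrite fM IH. Qed.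

Lemma idempotent_power_morph (G H : semigroupType) (f : G -> H) x e :
  {morph f : y z / y * z} -> idempotent_power x e -> idempotent_power (f x) (f e).
Proof.
move=> fM [ee [k eE]]; split; first by rewrite -fM ee.
by exists k; rewrite eE spow_morph.
Qed.

Lemma finite_set_inj (T U : Type) (f : T -> U) :
  injective f -> finite_set [set: U]%classic -> finite_set [set: T]%classic.
Proof.
move=> injf finU; apply: sub_finite_set (finite_preimage _ finU).
  by move=> ? _.
by move=> x y _ _; apply: injf.
Qed.

(** Since [c] does not depend on [f], a product can be lengthened beyond [c] before the sequence of
    its prefixes is formed. *)
Lemma finite_pigeonhole (T : choiceType) : finite_set [set: T]%classic ->
  exists c, forall f : nat -> T, exists i j, [/\ i < j, j <= c & f i = f j].
Proof.
move=> /finite_seqP[r rE]; exists (size r) => f.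
have /(uniqPn (f 0)) [i [j [ij]]] : ~~ uniq (map f (iota 0 (size r).+1)).
  apply: contraT => /negbNE/(@uniq_leq_size _ _ r).
  rewrite size_map size_iota ltnn; apply=> x _.
  by have : [set: T]%classic x by []; rewrite rE.
rewrite size_map size_iota => jr; rewrite !(nth_map 0%N) ?size_iota ?(ltn_trans ij) //.
by rewrite !nth_iota ?add0n ?(ltn_trans ij) // => fE; exists i, j.
Qed.

(* S with an identity adjoined: empty products make sense, and a factor from
   adj S may be absent. *)
Section Adjoin.
Variable S : semigroupType.

Definition adj : Type := option S.
HB.instance Definition _ := Choice.copy adj (option S).

Definition adj_mul (x y : adj) : adj :=
  match x, y with
  | Some a, Some b => Some (a * b)
  | None, _ => y
  | _, None => x
  end.

Fact adj_mulA : associative adj_mul.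
Proof. by move=> [x|] [y|] [z|] //=; rewrite mulgA. Qed.
Fact adj_1mul : left_id None adj_mul. Proof. by case. Qed.
Fact adj_mul1 : right_id None adj_mul. Proof. by case. Qed.

HB.instance Definition _ := isMonoid.Build adj adj_mulA adj_1mul adj_mul1.

Definition adjoin (x : S) : adj := Some x.

Lemma adjoinM : {morph adjoin : x y / x * y}. Proof. by []. Qed.
Lemma adjoin_inj : injective adjoin. Proof. by move=> x y []. Qed.

Definition iprod (s : seq S) : adj := \prod_(x <- s) adjoin x.

Lemma iprod_nil : iprod [::] = 1. Proof. exact: big_nil. Qed.
Lemma iprod_cons x s : iprod (x :: s) = adjoin x * iprod s.
Proof. exact: big_cons. Qed.
Lemma iprod_cat s t : iprod (s ++ t) = iprod s * iprod t.
Proof. exact: big_cat. Qed.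

Lemma mul_adjoin x (a : adj) : exists y, adjoin x * a = adjoin y.
Proof. by case: a => [a|]; [exists (x * a) | exists x]. Qed.

Lemma finite_adj : finite_set [set: S]%classic -> finite_set [set: adj]%classic.
Proof.
move=> finS; apply: (@sub_finite_set _ _ ([set None] `|` adjoin @` setT)%classic).
  by move=> [x|] _; [right; exists x | left].
by rewrite finite_setU; split; [exact: finite_set1 | exact: finite_image].
Qed.

End Adjoin.

Lemma map_nth_cat_cons (T : Type) (x0 x : T) s t :
  nth x0 (s ++ x :: t) (size s) = x.
Proof. by rewrite nth_cat ltnn subnn. Qed.

Lemma iprod_coarsen (S : semigroupType) k (s : seq S) :
  0 < k <= size s -> exists t, size t = k /\ iprod t = iprod s.
Proof.
move=> /andP[k0 ks]; have := cat_take_drop (size s - k).+1 s.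
case s1E: (take _ _) => [|x s1] sE.
  by move/(congr1 size): s1E; rewrite size_take_min /=; lia.
have [y yE] := mul_adjoin x (iprod s1).
exists (y :: drop (size s - k).+1 s); split; first by rewrite /= size_drop; lia.
by rewrite -[in RHS]sE iprod_cat !iprod_cons -yE.
Qed.

(* The variable x_k is coded by the number k. *)
Definition word_identity (S : semigroupType) n (w : seq nat) :=
  forall v : nat -> S, iprod (map v (iota 0 n)) = iprod (map v w).

(** * Left units of products *)

Section Core.
Variables (S : semigroupType) (n : nat) (w : seq nat).
Hypotheses (finS : finite_set [set: S]%classic) (Sw : word_identity S n w).

Lemma word_identity_nth x0 (s : seq S) :
  size s = n -> iprod s = iprod [seq nth x0 s i | i <- w].
Proof. by move=> sn; rewrite -Sw -sn map_nth_iota0 // take_size. Qed.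

Hypothesis size_w : n < size w.

(** The identity is applied to [z] followed by the last [n - 1] entries, where [z] absorbs [y] and
    the surplus. Expanding [z] again at one occurrence of x_0 brings [y] back, and the number of
    factors grows because [w] is longer than [n]. *)
Lemma iprod_grow w1 w2 y (s : seq S) :
  w = w1 ++ 0 :: w2 -> 0 < n <= (size s).+1 ->
  exists t s', [/\ size t = size w1, size s < size t + size s' &
    iprod (y :: s) = iprod (t ++ y :: s')].
Proof.
move=> wE /andP[n0 ns].
pose s1 := take (size s - n.-1) s; pose s2 := drop (size s - n.-1) s.
have [z zE] := mul_adjoin y (iprod s1).
pose v := nth z (z :: s2).
exists (map v w1), (s1 ++ map v w2).
have size_s2 : size s2 = n.-1 by rewrite size_drop; lia.
split; first by rewrite size_map.
  move: size_w; rewrite wE !size_cat /= !size_map size_takel; lia.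
have -> : iprod (y :: s) = iprod (z :: s2).
  by rewrite !iprod_cons -zE -mulgA -iprod_cat cat_take_drop.
rewrite (@word_identity_nth z) /=; last by rewrite size_s2 prednK.
by rewrite wE map_cat !iprod_cat !iprod_cons /= !mulgA -zE iprod_cat !mulgA.
Qed.

Lemma iprod_long m (s : seq S) : 0 \in w -> 0 < n <= size s ->
  exists s', n + m <= size s' /\ iprod s = iprod s'.
Proof.
move=> w0 /andP[n0 ns]; elim: m => [|m [s' [ms' ->]]].
  by exists s; rewrite addn0.
case: s' ms' => [|y s'] /= ms'; first by lia.
case/path.splitPr wE: w / w0 => [w1 w2].
have [|t [s2 [_ s2s ->]]] := @iprod_grow w1 w2 y s' wE; first by rewrite n0; lia.
by exists (t ++ y :: s2); rewrite size_cat /=; split=> //; lia.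
Qed.

Lemma left_unit_head k w' (s : seq S) : w = k :: w' -> 0 < k < n -> 0 \in w ->
  size s = n -> exists u, adjoin u * iprod s = iprod s.
Proof.
move=> wE /andP[k0 kn] w0 sn.
have [c cP] := finite_pigeonhole (finite_adj finS).
have [|r [rn ->]] := @iprod_long c s w0; first by rewrite sn leqnn andbT; lia.
(* Two prefixes, of lengths [k + i] and [k + j], have the same product, so the factor [u] between
   them, and with it an idempotent [e], can be inserted after the shorter one. *)
have [i [j [ij jc aE]]] := cP (fun i => iprod (take (k + i) r)).
pose u := take (j - i) (drop (k + i) r).
have uE : take (k + j) r = take (k + i) r ++ u.
  by rewrite -takeD; congr take; lia.
have [g gE] : exists g, iprod u = adjoin g.
  case uE': u uE => [|x u'] uE; last by rewrite iprod_cons; apply: mul_adjoin.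
  by move/(congr1 size): uE; rewrite cats0 !size_takel; lia.
have [e eP] := idempotent_power_exists g finS.
have aeE : iprod (take (k + i) r) * adjoin e = iprod (take (k + i) r).
  apply: (@idempotent_power_absorbr _ _ 1 (adjoin g)).
    exact: (idempotent_power_morph (@adjoinM S)).
  by rewrite mul1g -gE -iprod_cat -uE.
have [|a [ak aE']] := @iprod_coarsen S k (take (k + i) r).
  by rewrite size_takel; lia.
have [|[|x b] [bk bE]] := @iprod_coarsen S (n - k) (drop (k + i) r).
- by rewrite size_drop; lia.
- by rewrite /= in bk; lia.
have rE : iprod r = iprod (a ++ e * x :: b).
  rewrite -(cat_take_drop (k + i) r) !iprod_cat -bE aE' -{1}aeE !iprod_cons.
  by rewrite adjoinM !mulgA.
rewrite rE (@word_identity_nth e); last by rewrite size_cat ak; move: bk => /=; lia.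
exists e; rewrite wE /= -[in nth _ _ k]ak map_nth_cat_cons iprod_cons.
by rewrite mulgA -adjoinM mulgA (proj1 eP).
Qed.

Lemma left_unit_repeated w' (s : seq S) : w = 0 :: w' -> 0 \in w' -> 0 < n ->
  size s = n -> exists u, adjoin u * iprod s = iprod s.
Proof.
move=> wE w'0 n0 sn.
(* [P z]: the product has a factorization starting with [z] and still long enough to apply the
   identity. *)
pose P z := exists r, n.-1 <= size r /\ iprod s = iprod (z :: r).
have grow m z : P z -> exists r, n.-1 + m <= size r /\ iprod s = iprod (z :: r).
  move=> [r [nr ->]]; elim: m => [|m [r' [mr ->]]].
    by exists r; rewrite addn0.
  have [|t [r2 [/size0nil-> r2s ->]]] := @iprod_grow [::] w' z r' wE; first by lia.
  by exists r2; split=> //; move: r2s => /=; lia.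
have step z : P z -> exists z', P z' /\ exists t, adjoin z' = adjoin z * t * adjoin z.
  move=> /(grow n.-1)[r [nr sE]].
  pose r1 := take (size r - n.-1) r; pose r2 := drop (size r - n.-1) r.
  (* [y] starts with [z] and becomes the value of x_0, whose two occurrences in [w] give a prefix z
     t z. *)
  have [y yE] := mul_adjoin z (iprod r1).
  have r2n : size r2 = n.-1 by rewrite size_drop; lia.
  case/path.splitPr w'E: w' / w'0 => [w1 w2].
  pose v := nth y (y :: r2).
  have := @mul_adjoin _ z (iprod r1 * iprod (map v w1) * adjoin z).
  rewrite !mulgA => -[z' z'E]; exists z'; split; last first.
    by exists (iprod r1 * iprod (map v w1)); rewrite -z'E !mulgA.
  exists (r1 ++ map v w2); split.
    by rewrite size_cat size_takel; lia.
  rewrite sE iprod_cons -(cat_take_drop (size r - n.-1) r) iprod_cat mulgA yE.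
  rewrite -iprod_cons (@word_identity_nth y) /=; last by rewrite r2n prednK.
  rewrite wE w'E /= map_cat iprod_cons iprod_cat iprod_cons /= -/v -yE.
  by rewrite iprod_cons -z'E -yE iprod_cat !mulgA.
have [x [s' sE]] : exists x s', s = x :: s'.
  by case: s sn {P grow step} => [|x s'] sn; [rewrite -sn in n0 | exists x, s'].
have Px : P x by exists s'; split; [rewrite -sn sE | rewrite sE].
have /choice[f fP] : forall z, exists z', P z ->
    P z' /\ exists t, adjoin z' = adjoin z * t * adjoin z.
  by move=> z; case: (pselect (P z)) => [/step[z' ?]|]; [exists z' | exists z].
have Pf i : P (iter i f x) by elim: i => //= i /fP[].
have fle i j : i <= j -> exists t, adjoin (iter j f x) = adjoin (iter i f x) * t.
  move=> /subnK <-; elim: (j - i) => [|m [t tE]]; first by exists 1; rewrite mulg1.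
  have [_ [t' t'E]] := fP _ (Pf (m + i)).
  by rewrite addSn /= t'E tE; exists (t * t' * (adjoin (iter i f x) * t)); rewrite !mulgA.
(* The iterates of [f] descend by right multiplication. A repetition turns f z = z t' z into z = z
   t' z t, that is z = u z t with u = z t'. *)
have [c cP] := finite_pigeonhole finS.
have [i [j [/fle[t tE] _ ijE]]] := cP (fun i => iter i f x).
have [_ [t' t'E]] := fP _ (Pf i).
have [r [_ ->]] := Pf i; set z := iter i f x in ijE tE t'E *.
have [u uE] := mul_adjoin z t'.
have [e eP] := idempotent_power_exists u finS.
exists e; rewrite iprod_cons mulgA; congr (_ * _).
apply: (@idempotent_power_absorbl _ _ (adjoin u) t).
  exact: (idempotent_power_morph (@adjoinM S)).
by rewrite -uE -t'E -[f z]/(iter i.+1 f x) -tE -ijE.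
Qed.

Lemma left_unit (s : seq S) : 0 < n -> 0 \in w -> all (gtn n) w -> size s = n ->
  ~ (exists2 w', w = 0 :: w' & 0 \notin w') ->
  exists u, adjoin u * iprod s = iprod s.
Proof.
move=> n0 w0 wn sn nw; case wE: w => [|[|k] w']; first by rewrite wE in w0.
  apply: (left_unit_repeated wE) => //; apply: contraPT isT => w'0.
  by case: nw; exists w'.
apply: (left_unit_head wE) => //; move: wn.
by rewrite wE /= => /andP[].
Qed.

End Core.

(** * Left-right duality *)

Section Opposite.
Variable S : semigroupType.

Definition opp : Type := S.
HB.instance Definition _ := Choice.copy opp S.

Definition opp_mul (x y : opp) : opp := (y : S) * x.

Fact opp_mulA : associative opp_mul.
Proof. by move=> x y z; rewrite /opp_mul mulgA. Qed.

HB.instance Definition _ := isSemigroup.Build opp opp_mulA.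

Lemma adj_oppM (x y : adj opp) : x * y = ((y : adj S) * x : adj S).
Proof. by case: x y => [x|] [y|]. Qed.

Lemma iprod_opp (s : seq S) : iprod (s : seq opp) = iprod (rev s) :> option S.
Proof.
elim: s => [|x s IH]; first by rewrite !iprod_nil.
rewrite rev_cons -cats1 iprod_cat !iprod_cons iprod_nil mulg1.
by rewrite [LHS]adj_oppM IH.
Qed.

Lemma idempotent_power_opp x e :
  @idempotent_power S x e -> @idempotent_power opp x e.
Proof.
move=> [ee [k eE]]; split; first exact: ee.
by exists k; rewrite eE; elim: k {eE} => // k IH; rewrite spowSr IH.
Qed.

End Opposite.

(** Besides the reversal, the variables are renumbered so that the left side of the identity is
    again x_0 ... x_(n-1). *)
Definition word_mirror n (w : seq nat) := rev [seq n.-1 - i | i <- w].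

Lemma word_identity_opp (S : semigroupType) n w :
  word_identity S n w -> word_identity (opp S) n (word_mirror n w).
Proof.
move=> Sw v; rewrite [LHS]iprod_opp [RHS]iprod_opp /word_mirror map_rev revK.
rewrite -map_comp -Sw -map_rev; congr (@iprod S _).
apply: (@eq_from_nth _ (v 0)); first by rewrite !size_map size_rev.
move=> i; rewrite size_map size_rev size_iota => ltin.
rewrite !(nth_map 0) ?size_rev ?size_iota // nth_rev ?size_iota //.
by rewrite !nth_iota //=; [congr v; lia | lia].
Qed.

(** * From units to group elements *)

Lemma iprod_around (S : semigroupType) n k (u p f : S) :
    k < n -> u * p = p -> p * f = p ->
  iprod [seq if i < k then u else if i == k then p else f | i <- iota 0 n]
    = adjoin p.
Proof.
set v := fun i => _; move=> kn up pf.
have absl s : all (gtn k) s -> iprod (map v s) * adjoin p = adjoin p.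
  elim: s => [|i s IH] /=; first by rewrite iprod_nil mul1g.
  by rewrite iprod_cons /v => /andP[-> /IH sp]; rewrite -mulgA sp -adjoinM up.
have absr s : all (ltn k) s -> adjoin p * iprod (map v s) = adjoin p.
  elim: s => [|i s IH] /=; first by rewrite iprod_nil mulg1.
  rewrite iprod_cons {1}/v => /andP[ki /IH ps].
  by rewrite ltnNge (ltnW ki) gtn_eqF //= mulgA -adjoinM pf.
have -> : n = k + (n - k.+1).+1 by lia.
rewrite iotaD map_cat /= add0n iprod_cat iprod_cons {2}/v ltnn eqxx absr.
  by apply: absl; apply/allP => i /=; rewrite mem_iota.
by apply/allP => i /=; rewrite mem_iota => /andP[].
Qed.

Lemma nonuniq_split (T : eqType) (w : seq T) : ~~ uniq w ->
  exists w1 w2 w3 k, w = w1 ++ k :: w2 ++ k :: w3.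
Proof.
elim: w => //= k w IH; rewrite negb_and negbK => /orP[/path.splitPr[w2 w3]|].
  by exists [::], w2, w3, k.
by move=> /IH[w1 [w2 [w3 [l ->]]]]; exists (k :: w1), w2, w3, l.
Qed.

Lemma nonsorted_split w : ~~ sorted ltn w ->
  exists w1 w2 k l, l <= k /\ w = w1 ++ k :: l :: w2.
Proof.
elim: w => //= k [|l w] //= IH; rewrite negb_and -leqNgt => /orP[lk|/IH].
  by exists [::], w, k, l.
by move=> [w1 [w2 [i [j [ij ->]]]]]; exists (k :: w1), w2, i, j.
Qed.

Lemma idempotent_power_factor (M : monoidType) (x e : M) :
  idempotent_power x e -> exists y, e = x * y.
Proof.
move=> [_ [[|k] ->]]; first by exists 1; rewrite mulg1.
by exists (spow x k).
Qed.

(** Reading the hypothesis as a p (b p c) gives p = p (b p c) y for some [y]; reading this as (p b)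
    p (c y) gives p = (p b) z p. *)
Lemma regular_of_sandwich (M : monoidType) (a b c p : M) :
  finite_set [set: M]%classic -> p = a * p * b * p * c -> exists t, p = p * t * p.
Proof.
move=> finM pE.
have [e eP] := idempotent_power_exists (b * p * c) finM.
have [y yE] := idempotent_power_factor eP.
have := @idempotent_power_absorbr _ p a _ _ eP.
rewrite !mulgA -pE yE !mulgA => /(_ erefl)/esym {}pE.
have [f fP] := idempotent_power_exists (p * b) finM.
have [z zE] := idempotent_power_factor fP.
have := @idempotent_power_absorbl _ p _ (c * y) _ fP.
by rewrite zE !mulgA -pE => /(_ erefl)/esym; exists (b * z); rewrite mulgA.
Qed.

Section CoreUnit.
Variables (S : semigroupType) (n : nat) (w : seq nat).
Hypotheses (finS : finite_set [set: S]%classic) (Sw : word_identity S n w).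
Hypotheses (w_lt : all (gtn n) w) (size_w : n < size w).

Lemma word_nonuniq : ~~ uniq w.
Proof.
apply: contraL size_w => uw; rewrite -leqNgt -[n](size_iota 0).
by apply: uniq_leq_size => // i /(allP w_lt); rewrite mem_iota.
Qed.

Lemma word_nonsorted : ~~ sorted ltn w.
Proof. by apply: contra word_nonuniq => /(sorted_uniq ltn_trans ltnn). Qed.

(* Evaluating the identity at u, .., u, p, f, .., f, first with p at a repeated
   letter, then with p at the smaller letter of a factor x_k x_l, l <= k. *)
Lemma units_regular (u p f : S) : u * p = p -> p * f = p ->
  exists q, p = p * q * p.
Proof.
move=> up pf; have [w1 [w2 [w3 [k wE]]]] := nonuniq_split word_nonuniq.
have kn : k < n by apply: (allP w_lt); rewrite wE mem_cat mem_head orbT.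
have := iprod_around kn up pf; set v := fun i => _; rewrite Sw wE.
rewrite map_cat /= map_cat /= iprod_cat iprod_cons iprod_cat iprod_cons.
rewrite [v k]/v ltnn eqxx.
set a := iprod _; set b := iprod _; set c := iprod _ => pE.
rewrite !mulgA in pE.
have [t tE] := regular_of_sandwich (finite_adj finS) (esym pE).
(* [t] may be the adjoined identity, whereas t p t always comes from [S]. *)
have [q qE] : exists q, t * adjoin p * t = adjoin q.
  by case: t {tE} => [t|]; [exists (t * p * t) | exists p].
exists q; apply: (@adjoin_inj S); rewrite !adjoinM -qE !mulgA.
by rewrite -tE -tE.
Qed.

Lemma regular_unit (p q e : S) :
  p = p * q * p -> idempotent_power p e -> e * p = p.
Proof.
move=> pq eP; have [w1 [w2 [k [l [lk wE]]]]] := nonsorted_split word_nonsorted.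
have ln : l < n by apply: (allP w_lt); rewrite wE mem_cat !inE eqxx !orbT.
have qp : p * (q * p) = p by rewrite mulgA -pq.
have := iprod_around ln (esym pq) qp; set v := fun i => _; rewrite Sw wE.
rewrite map_cat /= iprod_cat !iprod_cons [v l]/v ltnn eqxx.
(* Since l <= k, the value of x_k is [p] or [q * p], so it ends in [p]. *)
have [b bE] : exists b, adjoin (v k) = b * adjoin p.
  rewrite /v ltnNge lk; case: ifP => _ /=; first by exists 1; rewrite mul1g.
  by exists (adjoin q).
rewrite bE !mulgA; set a := iprod _; set c := iprod _ => pE.
(* The equation p = (a b) p (p c) yields p = p (p c) y, and p = p p (c y) makes the idempotent power
   of [p] a left unit of [p]. *)
have [f fP] := idempotent_power_exists (adjoin p * c) (finite_adj finS).
have [y yE] := idempotent_power_factor fP.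
have := @idempotent_power_absorbr _ (adjoin p) (a * b) _ _ fP.
rewrite !mulgA pE yE !mulgA => /(_ erefl)/esym {}pE.
apply: (@adjoin_inj S); rewrite adjoinM.
apply: (@idempotent_power_absorbl _ _ (adjoin p) (c * y)).
  exact: (idempotent_power_morph (@adjoinM S)).
by rewrite mulgA.
Qed.

End CoreUnit.

(** * Removal of an end variable *)

Section LeftAct.
Variables (S : semigroupType) (finS : finite_set [set: S]%classic).

Definition left_act_rel (x y : S) : bool := `[< forall a, a * x = a * y >].

Fact left_act_equiv : equiv_class_of left_act_rel.
Proof.
split.
- by move=> x; apply/asboolP.
- by move=> x y; apply/asboolP/asboolP => xy a; rewrite xy.
- by move=> y x z /asboolP xy /asboolP yz; apply/asboolP => a; rewrite xy.
Qed.

Definition left_act_equivr := EquivRelPack left_act_equiv.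

Fact left_act_mul x x' y y' : left_act_equivr x x' -> left_act_equivr y y' ->
  left_act_equivr (x * y) (x' * y').
Proof.
move=> /asboolP xx' /asboolP yy'; apply/asboolP => a.
by rewrite !mulgA xx' yy'.
Qed.

Fact left_act_finite : finite_set [set: {eq_quot left_act_equivr}]%classic.
Proof.
apply: (@sub_finite_set _ _ ((\pi_{eq_quot left_act_equivr}) @` setT)%classic).
  by move=> x _; exists (repr x); rewrite ?reprK.
exact: finite_image.
Qed.

(* Two elements are identified when they act in the same way by right
   multiplication, i.e. in contexts that provide a left factor. *)
Definition left_act := FCong left_act_mul left_act_finite.

Lemma left_actP (x y : S) :
  \pi_(fquot left_act) x = \pi_(fquot left_act) y <-> forall a, a * x = a * y.
Proof.
split=> [/(@eqquotP _ _ (fquot left_act))/asboolP //|xy].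
by apply: pi_eq; apply/asboolP.
Qed.

End LeftAct.

Lemma iprod_map (S T : semigroupType) (f : S -> T) (s : seq S) :
  {morph f : x y / x * y} -> iprod (map f s) = omap f (iprod s).
Proof.
move=> fM; elim: s => [|x s IH]; first by rewrite !iprod_nil.
by rewrite !iprod_cons IH; case: (iprod s) => //= y; rewrite fM.
Qed.

(* The identity w implies that in x_0 ... x_(i+l+k-1) the factor made of the
   l letters after the first i ones can be multiplied by its omega power. *)
Definition omega_rule i l k w := forall S : semigroupType,
  finite_set [set: S]%classic -> word_identity S (i + l + k) w ->
  forall (s1 s2 s3 : seq S) c e,
    size s1 = i -> size s2 = l -> size s3 = k ->
    iprod s2 = adjoin c -> idempotent_power c e ->
    iprod (s1 ++ s2 ++ s3) = iprod (s1 ++ (e * c) :: s3).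

Lemma omega_rule_opp i l k w :
  omega_rule k l i (word_mirror (i + l + k) w) -> omega_rule i l k w.
Proof.
move=> rule S finS Sw s1 s2 s3 c e s1i s2l s3k cE eP.
(* Reversal turns [e * c] into [c * e]. *)
have ec : e * c = c * e by case: eP => _ [m ->]; rewrite -spowSr.
have := rule (opp S) finS; have -> : k + l + i = i + l + k by lia.
move=> /(_ (word_identity_opp Sw) (rev s3) (rev s2) (rev s1) c e).
rewrite !size_rev => /(_ s3k s2l s1i) opp_eq.
have {opp_eq} : iprod (rev s3 ++ rev s2 ++ rev s1 : seq (opp S)) =
    iprod (rev s3 ++ (c * e) :: rev s1 : seq (opp S)) :> option S.
  by apply: opp_eq; [rewrite iprod_opp revK | exact: idempotent_power_opp].
rewrite !iprod_opp !rev_cat rev_cons !revK -catA ec.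
by rewrite -cats1 -catA.
Qed.

(** The identity [w] holds in the quotient [T], because x_0 supplies the arbitrary left factor [b].
    Conversely, the head [a] of [s1] is the left factor that brings an equality in [T] back to
    [S]. *)
Lemma omega_rule_strip i l k w : 0 < i + l + k -> w != [::] ->
  omega_rule i l k w -> omega_rule i.+1 l k (0 :: map succn w).
Proof.
move=> n0 w0 rule S finS Sw [//|a s1] s2 s3 c e [s1i] s2l s3k cE eP.
pose T : semigroupType := fquot (left_act finS).
pose p : S -> T := \pi_(fquot (left_act finS)).
have pM : {morph p : x y / x * y} by move=> x y; apply/esym/pi_fquot_mul.
have quot_eq (s t : seq S) : s != [::] -> t != [::] ->
    (forall b, iprod (b :: s) = iprod (b :: t)) <->
    iprod (map p s) = iprod (map p t).
  case: s t => [//|x s] [//|y t] _ _; rewrite !(iprod_map _ pM).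
  rewrite !(iprod_cons x, iprod_cons y).
  have [z zE] := mul_adjoin x (iprod s); have [z' z'E] := mul_adjoin y (iprod t).
  rewrite zE z'E; split=> [st|[/left_actP st] b].
    congr (Some _); apply/left_actP => b; apply: (@adjoin_inj S).
    by rewrite !adjoinM -zE -z'E -!iprod_cons.
  by rewrite !iprod_cons zE z'E -!adjoinM st.
have Tw : word_identity T (i + l + k) w.
  move=> v; pose v' := fun j => repr (v j).
  have vE r : map v r = map p (map v' r).
    by rewrite -map_comp; apply: eq_map => j; rewrite /= /p reprK.
  rewrite !vE; apply/quot_eq; first by rewrite -size_eq0 !size_map size_iota -lt0n.
    by rewrite -size_eq0 !size_map size_eq0.
  move=> b; have := Sw (fun j => if j is j'.+1 then v' j' else b).
  by rewrite !addSn /= (iotaDl 1 0) -!map_comp.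
suff /quot_eq -> // : iprod (map p (s1 ++ s2 ++ s3)) =
    iprod (map p (s1 ++ (e * c) :: s3)).
- by [].
- by rewrite -size_eq0 !size_cat s1i s2l s3k addnA -lt0n.
- by rewrite -size_eq0 size_cat addnS.
rewrite !map_cat /= pM; apply: (rule T) => //; rewrite ?size_map //.
- exact: fcong_finite.
- by rewrite (iprod_map _ pM) cE.
- exact: idempotent_power_morph.
Qed.

Definition left_strippable w := exists2 w', w = 0 :: w' & 0 \notin w'.

Lemma left_strippableP n w : all (gtn n.+1) w -> {subset iota 0 n.+1 <= w} ->
    n.+1 < size w -> left_strippable w ->
  exists w', [/\ w = 0 :: map succn w', all (gtn n) w', {subset iota 0 n <= w'},
    n < size w' & w' != [::]].
Proof.
move=> wn wsub sizew [w' wE w'0].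
have w'E : w' = map succn (map predn w').
  rewrite -map_comp -[LHS]map_id; apply/eq_in_map => -[|i] //=.
  by rewrite (negPf w'0).
exists (map predn w'); rewrite -w'E size_map -size_eq0 size_map; move: sizew.
rewrite wE /= ltnS => sizew'; split=> //; last by rewrite -lt0n; apply: leq_trans sizew'.
  apply/allP => _ /mapP[[|i] iw' ->] /=; first by rewrite iw' in w'0.
  by have /(allP wn) : i.+1 \in w by rewrite wE inE iw' orbT.
move=> i; rewrite mem_iota => /= i_n.
have : i.+1 \in w by apply: wsub; rewrite mem_iota.
by rewrite wE inE /= => iw'; apply/mapP; exists i.+1.
Qed.

Lemma size_word_mirror n w : size (word_mirror n w) = size w.
Proof. by rewrite size_rev size_map. Qed.

Lemma word_mirror_lt n w : 0 < n -> all (gtn n) (word_mirror n w).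
Proof.
move=> n0; rewrite all_rev; apply/allP => _ /mapP[i _ ->] /=.
by rewrite -[ltnRHS](prednK n0) ltnS leq_subr.
Qed.

Lemma word_mirror_full n w :
  {subset iota 0 n <= w} -> {subset iota 0 n <= word_mirror n w}.
Proof.
move=> wsub i; rewrite mem_iota add0n /= => i_n; rewrite mem_rev.
by apply/mapP; exists (n.-1 - i); [apply: wsub; rewrite mem_iota|]; lia.
Qed.

Lemma omega_rule_core n w : 0 < n -> all (gtn n) w -> {subset iota 0 n <= w} ->
    n < size w -> ~ left_strippable w -> ~ left_strippable (word_mirror n w) ->
  omega_rule 0 n 0 w.
Proof.
move=> n0 wn wsub sizew nl nr S finS; rewrite add0n addn0 => Sw.
move=> s1 s2 s3 p e /size0nil -> s2n /size0nil -> pE eP.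
rewrite cats0 pE iprod_cons iprod_nil mulg1; congr (adjoin _).
have w0 : 0 \in w by apply: wsub; rewrite mem_iota.
have [u] := left_unit finS Sw sizew n0 w0 wn s2n nl.
rewrite pE -adjoinM => /(@adjoin_inj S) up.
have w0' : 0 \in word_mirror n w by apply: word_mirror_full; rewrite ?mem_iota.
have sizew' : n < size (word_mirror n w) by rewrite size_word_mirror.
have s2n' : size (rev s2 : seq (opp S)) = n by rewrite size_rev.
have [f] := @left_unit (opp S) _ _ finS (word_identity_opp Sw) sizew' _ n0 w0'
  (word_mirror_lt w n0) s2n' nr.
have -> : iprod (rev s2 : seq (opp S)) = adjoin (p : opp S).
  by rewrite [LHS]iprod_opp revK.
rewrite -adjoinM => /(@adjoin_inj (opp S)) pf.
have [q pq] := units_regular finS Sw wn sizew up pf.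
by rewrite (regular_unit finS Sw wn sizew pq eP).
Qed.

(** Each removal of an end variable lowers [n] by one, a right end being a left end of the mirrored
    word. When neither end can be removed, the core case covers the whole product. *)
Lemma omega_rule_exists n w : all (gtn n) w -> {subset iota 0 n <= w} ->
  n < size w -> exists i l k, [/\ 0 < l, n = i + l + k & omega_rule i l k w].
Proof.
elim: n w => [[|i w]//|n IH w wn wsub sizew].
have strip w1 : all (gtn n.+1) w1 -> {subset iota 0 n.+1 <= w1} ->
    n.+1 < size w1 -> left_strippable w1 ->
  exists i l k, [/\ 0 < l, n.+1 = i + l + k & omega_rule i l k w1].
  move=> w1n w1sub sizew1 /(left_strippableP w1n w1sub sizew1).
  move=> [w' [-> w'n w'sub sizew' w'0]].
  have [i [l [k [l0 nE rule]]]] := IH w' w'n w'sub sizew'.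
  exists i.+1, l, k; split=> //; first by rewrite nE.
  by apply: omega_rule_strip => //; lia.
case: (pselect (left_strippable w)) => [|nl]; first exact: strip.
case: (pselect (left_strippable (word_mirror n.+1 w))) => [sr|nr].
  have [||||i [l [k [l0 nE rule]]]] := strip (word_mirror n.+1 w) => //.
  - exact: word_mirror_lt.
  - exact: word_mirror_full.
  - by rewrite size_word_mirror.
  exists k, l, i; split=> //; first by lia.
  by apply: omega_rule_opp; have <- : n.+1 = k + l + i by lia.
exists 0, n.+1, 0; split=> //; first by rewrite addn0.
exact: omega_rule_core.
Qed.

(** * Congruences and the topology of the profinite completion *)

Section KernelCongruence.
Variables (G : semigroupType) (T : Type) (F : G -> T).
Hypothesis F_cong : forall x x' y y', F x = F x' -> F y = F y' ->
  F (x * y) = F (x' * y').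
Hypothesis finT : finite_set [set: T]%classic.

Definition ker_rel (x y : G) : bool := `[< F x = F y >].

Fact ker_rel_equiv : equiv_class_of ker_rel.
Proof.
split.
- by move=> x; apply/asboolP.
- by move=> x y; apply/asboolP/asboolP.
- by move=> y x z /asboolP xy /asboolP yz; apply/asboolP; rewrite xy.
Qed.

Definition ker_equiv := EquivRelPack ker_rel_equiv.

Fact ker_mul x x' y y' :
  ker_equiv x x' -> ker_equiv y y' -> ker_equiv (x * y) (x' * y').
Proof. by move=> /asboolP xx' /asboolP yy'; apply/asboolP/F_cong. Qed.

Fact ker_finite : finite_set [set: {eq_quot ker_equiv}]%classic.
Proof.
apply: (@finite_set_inj _ _ (fun q => F (repr q))) finT => q r qr.
by rewrite -[q]reprK -[r]reprK; apply/eqquotP/asboolP.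
Qed.

Definition ker_fcong := FCong ker_mul ker_finite.

Lemma ker_fcongP x y : ker_fcong x y <-> F x = F y.
Proof. by split=> /asboolP. Qed.

End KernelCongruence.

Section Refinement.
Variable G : semigroupType.

Definition fcong_total : fcong G.
Proof. by apply: (@ker_fcong G unit (fun=> tt)) => //; exact: finite_finset. Defined.

Lemma fcong_meet (t t' : fcong G) :
  exists u : fcong G, subrel u t /\ subrel u t'.
Proof.
pose F x := (\pi_(fquot t) x, \pi_(fquot t') x).
have F_cong x x' y y' : F x = F x' -> F y = F y' -> F (x * y) = F (x' * y').
  by move=> [xx' xx''] [yy' yy'']; rewrite /F -!pi_fquot_mul xx' xx'' yy' yy''.
have finF : finite_set [set: fquot t * fquot t']%classic.
  by rewrite -setXTT; apply: finite_setX; apply: fcong_finite.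
exists (ker_fcong F_cong finF).
by split=> x y /ker_fcongP[] /eqquotP // _ /eqquotP.
Qed.

Lemma fcong_big_meet (I : eqType) (r : seq I) (t : I -> fcong G) :
  exists u : fcong G, forall i, i \in r -> subrel u (t i).
Proof.
elim: r => [|i r [u ut]]; first by exists fcong_total.
have [u' [u'u u't]] := fcong_meet u (t i); exists u' => j.
by rewrite inE => /predU1P[->//|/ut uj] x y /u'u/uj.
Qed.

Lemma pcoord_pembed (x : G) (t : fcong G) : pcoord (pembed x) t = \pi_(fquot t) x.
Proof. by []. Qed.

Lemma pcoord_refine (x y : profinite G) (t u : fcong G) : subrel u t ->
  pcoord x u = pcoord y u -> pcoord x t = pcoord y t.
Proof. by move=> ut xy; rewrite (pcoord_coherent x ut) (pcoord_coherent y ut) xy. Qed.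

Lemma pembedM : {morph @pembed G : x y / x * y}.
Proof. by move=> x y; apply: pcoord_inj => t; apply/esym/pi_fquot_mul. Qed.

Lemma pcoordM (t : fcong G) : {morph (@pcoord G)^~ t : x y / x * y}.
Proof. by []. Qed.

Lemma profinite_cvg (F : set_system (profinite G)) (x : profinite G) :
  Filter F -> (forall t, F [set y | pcoord y t = pcoord x t]%classic) ->
  (F --> x)%classic.
Proof.
move=> FF Ft A [_ [[B oB <-] Bx sBA]]; apply: filterS sBA _.
have cvgF : (set_val @ F --> (set_val x : fquot_product G))%classic.
  apply/cvg_sup => t C [_ [[D oD <-] Dx sDC]].
  suff : F (set_val @^-1` C)%classic by [].
  apply: filterS (Ft t) => y yx; apply: sDC; move: Dx.
  by rewrite /= -[set_val y t]/(pcoord y t) yx.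
by apply: cvgF; apply: open_nbhs_nbhs; split.
Qed.

(** Any two congruences have a common refinement, so the sets [B t] form a filter base, and its
    filter converges to [x]. *)
Lemma nbhs_profinite (x : profinite G) (A : set (profinite G)) : nbhs x A ->
  exists t, forall y, pcoord y t = pcoord x t -> A y.
Proof.
pose B t := [set y : profinite G | pcoord y t = pcoord x t]%classic.
have FF : Filter (filter_from [set: fcong G]%classic B).
  apply: filter_from_filter; first by exists fcong_total.
  move=> t t' _ _; have [u [ut ut']] := fcong_meet t t'.
  by exists u => // y yx; split; apply: pcoord_refine yx.
have cvgF : (filter_from [set: fcong G]%classic B --> x)%classic.
  by apply: profinite_cvg => t; exists t.
by move=> /cvgF[t _ sBA]; exists t.
Qed.

Lemma nbhs_pcoord (x : profinite G) t :
  nbhs x [set y | pcoord y t = pcoord x t]%classic.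
Proof.
pose K (t : fcong G) := discrete_topology (fquot t).
have c1 := @initial_continuous _ _ (set_val : profinite G -> fquot_product G) x.
have c2 := @proj_continuous (fcong G) K t (set_val x).
exact: (continuous_comp c1 c2) (discrete_set1 (pcoord x t : K t)).
Qed.

Lemma continuous_locally_constant (S : choiceType) (f : profinite G -> S) :
  continuous (f : _ -> discrete_topology S) <->
  forall x, exists t, forall y, pcoord y t = pcoord x t -> f y = f x.
Proof.
split=> [fc x|fc x A /nbhs_singleton Afx].
  by have /fc/nbhs_profinite := discrete_set1 (f x : discrete_topology S).
have [t ft] := fc x; apply: filterS (nbhs_pcoord x t) => y yx.
by rewrite /= (ft _ yx).
Qed.

(** [f] is constant near [pomega x], and in a suitable finite quotient [pomega x] agrees with a
    power of [x]. Hence its image is an idempotent power of [f x], which is unique. *)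
Lemma continuous_pomega (S : semigroupType)
    (f : {multiplicative profinite G -> S}) x :
  finite_set [set: S]%classic -> continuous (f : _ -> discrete_topology S) ->
  f (pomega x) = omega (f x).
Proof.
move=> finS /continuous_locally_constant/(_ (pomega x))[t ft].
apply: (@idempotent_power_uniq _ (f x)); last exact: omegaP.
split.
  rewrite -gmulfM; congr (f _); apply: pcoord_inj => u.
  by have [] := omegaP (pcoord x u) (@fcong_finite _ u).
have [_ [k ek]] := omegaP (pcoord x t) (@fcong_finite _ t).
exists k; rewrite -(spow_morph _ _ (@gmulfM _ _ f)) ft //.
by rewrite (spow_morph _ _ (pcoordM t)) -ek.
Qed.

End Refinement.

Lemma finite_fun (T U : choiceType) : finite_set [set: T]%classic ->
  finite_set [set: U]%classic -> finite_set [set: T -> U]%classic.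
Proof.
move=> /finite_seqP[r rE] /finite_seqP[q qE].
have rT x : x \in r by have : [set: T]%classic x by []; rewrite rE.
have qU y : y \in q by have : [set: U]%classic y by []; rewrite qE.
pose F (f : T -> U) : (size r).-tuple 'I_(size q).+1 :=
  map_tuple (fun x => inord (index (f x) q)) (in_tuple r).
apply: (@finite_set_inj _ _ F); last exact: finite_finset.
move=> f g /(congr1 val)/= /eq_in_map fg; apply/funext => x.
have ltq y : index y q < (size q).+1 by rewrite ltnS index_size.
have /(congr1 val) := fg x (rT x); rewrite /= !inordK // => ifg.
by rewrite -(nth_index (f x) (qU (f x))) ifg nth_index.
Qed.

(** * Evaluation of profinite words in a finite semigroup *)

Section Evaluation.
Variables (A : finType) (S : semigroupType).
Hypothesis finS : finite_set [set: S]%classic.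

Lemma weval_exists (v : A -> S) (w : word A) :
  exists y, iprod (map v (val w)) = adjoin y.
Proof.
by case: w => [[|a s] //= _]; rewrite iprod_cons; apply: mul_adjoin.
Qed.

Definition weval (v : A -> S) (w : word A) : S := sval (cid (weval_exists v w)).

Lemma wevalE v w : adjoin (weval v w) = iprod (map v (val w)).
Proof. exact/esym/(svalP (cid (weval_exists v w))). Qed.

Lemma wevalM v : {morph weval v : w w' / w * w'}.
Proof.
move=> w w'; apply: (@adjoin_inj S).
by rewrite adjoinM !wevalE map_cat iprod_cat.
Qed.

Lemma weval_letter v a : weval v (letter a) = v a.
Proof. by apply: (@adjoin_inj S); rewrite wevalE iprod_cons iprod_nil mulg1. Qed.

(** All valuations are taken together, so that a single finite quotient of the free semigroup
    determines every evaluation in [S]. *)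
Definition weval_all (w : word A) : (A -> S) -> S := weval^~ w.

Fact weval_all_cong w w' z z' : weval_all w = weval_all w' ->
  weval_all z = weval_all z' -> weval_all (w * z) = weval_all (w' * z').
Proof.
move=> ww' zz'; apply/funext => v; rewrite /weval_all !wevalM.
by congr (_ * _); [apply: (congr1 (fun F => F v) ww')
                  | apply: (congr1 (fun F => F v) zz')].
Qed.

Fact weval_all_finite : finite_set [set: (A -> S) -> S]%classic.
Proof. by do 2!apply: finite_fun => //; exact: finite_finset. Qed.

Definition weval_fcong : fcong (word A) :=
  ker_fcong weval_all_cong weval_all_finite.

Definition peval (v : A -> S) (x : profinite_word A) : S :=
  weval v (repr (pcoord x weval_fcong)).

Lemma peval_pcoord v (x : profinite_word A) (w : word A) :
  pcoord x weval_fcong = \pi_(fquot weval_fcong) w -> peval v x = weval v w.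
Proof.
rewrite /peval => ->; have /ker_fcongP := repr_pi weval_fcong w.
exact: (congr1 (fun F => F v)).
Qed.

Fact pevalM v : {morph peval v : x y / x * y}.
Proof.
move=> x y; rewrite /= -[RHS](wevalM v (repr (pcoord x _)) (repr (pcoord y _))).
apply: peval_pcoord.
by rewrite -pi_fquot_mul !reprK.
Qed.

HB.instance Definition _ v :=
  isMultiplicative.Build (profinite_word A) S (peval v) (pevalM v).

Lemma peval_letter v a : peval v (pletter a) = v a.
Proof. by rewrite -[RHS]weval_letter; apply: peval_pcoord. Qed.

Lemma continuous_peval v : continuous (peval v : _ -> discrete_topology S).
Proof.
apply/continuous_locally_constant => x; exists weval_fcong => y yx.
by rewrite /peval yx.
Qed.

End Evaluation.

Lemma omega_rule_missing n k w : k < n -> k \notin w ->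
  omega_rule k 1 (n - k.+1) w.
Proof.
move=> kn kw S finS; have -> : k + 1 + (n - k.+1) = n by lia.
move=> Sw s1 [//|x [|//]] s3 c e s1k _ s3n.
rewrite iprod_cons iprod_nil mulg1 => /(@adjoin_inj S) -> _.
have nthE d : iprod (s1 ++ d :: s3) = iprod [seq nth c (s1 ++ d :: s3) i | i <- w].
  by apply: (word_identity_nth Sw); rewrite size_cat /=; lia.
rewrite [LHS]nthE [RHS]nthE; congr iprod; apply/eq_in_map => i iw; rewrite !nth_cat s1k.
case: (ltngtP i k) => [//|ki|ik]; last by rewrite ik (negPf kw) in iw.
by rewrite -(subnSK ki).
Qed.

Lemma filter_iota_range N a b : a <= b <= N ->
  [seq k <- iota 0 N | a <= k < b] = iota a (b - a).
Proof.
move=> /andP[ab bN]; have -> : N = a + ((b - a) + (N - b)) by lia.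
rewrite !iotaD !filter_cat add0n (subnKC ab).
rewrite (eq_in_filter (a2 := pred0)) ?filter_pred0; last first.
  by move=> k; rewrite mem_iota /=; lia.
rewrite (eq_in_filter (a2 := predT)) ?filter_predT; last first.
  by move=> k; rewrite mem_iota /=; lia.
rewrite (eq_in_filter (a2 := pred0)) ?filter_pred0 ?cats0 //.
by move=> k; rewrite mem_iota /=; lia.
Qed.

(** * The sides of the identities in an arbitrary semigroup *)

Section Shapes.
Variables (n : nat) (G : semigroupType) (x : 'I_n.+1 -> G).

(** With [xvar] for [x] this is [xprod]; the general form can be carried along morphisms. *)
Definition prod_of : G :=
  rmuls (x ord0) [seq x k | k : 'I_n.+1 <- enum 'I_n.+1 & (0 < k)%N].

Definition factor_of (i j : 'I_n.+1) : G :=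
  rmuls (x i) [seq x k | k : 'I_n.+1 <- enum 'I_n.+1 & (i < k <= j)%N].

Definition replaced_of (i j : 'I_n.+1) (c : G) : G :=
  rmuls (lmuls [seq x k | k : 'I_n.+1 <- enum 'I_n.+1 & (k < i)%N] c)
        [seq x k | k : 'I_n.+1 <- enum 'I_n.+1 & (j < k)%N].

Lemma adjoin_rmuls (a : G) s : adjoin (rmuls a s) = adjoin a * iprod s.
Proof.
elim: s a => [|b s IH] a /=; first by rewrite iprod_nil mulg1.
by rewrite IH iprod_cons mulgA.
Qed.

Lemma adjoin_lmuls s (a : G) : adjoin (lmuls s a) = iprod s * adjoin a.
Proof.
elim: s => [|b s IH] /=; first by rewrite iprod_nil mul1g.
by rewrite adjoinM IH iprod_cons mulgA.
Qed.

Let y (m : nat) : G := x (inord m).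

Lemma filter_enum_ord (P : pred nat) a b : a <= b <= n.+1 ->
    (forall k : 'I_n.+1, P k = (a <= k < b)) ->
  [seq x k | k : 'I_n.+1 <- enum 'I_n.+1 & P k] = map y (iota a (b - a)).
Proof.
move=> abn PE; rewrite -(filter_iota_range abn) -val_enum_ord filter_map -map_comp.
rewrite (eq_filter (a2 := preim val (fun k => a <= k < b))) //.
by apply: eq_map => k; rewrite /= /y inord_val.
Qed.

Lemma adjoin_prod_of : adjoin prod_of = iprod (map y (iota 0 n.+1)).
Proof.
rewrite adjoin_rmuls (@filter_enum_ord (fun k => 0 < k) 1 n.+1) ?leqnn //.
  by rewrite subn1 /= iprod_cons /y; congr (adjoin (x _) * _); apply: val_inj; rewrite /= inordK.
by move=> k; rewrite ltn_ord andbT.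
Qed.

Lemma prod_of_enum : adjoin prod_of = iprod (map x (enum 'I_n.+1)).
Proof.
rewrite adjoin_prod_of -val_enum_ord -map_comp; congr iprod.
by apply: eq_map => k; rewrite /= /y inord_val.
Qed.

Lemma adjoin_factor_of (i j : 'I_n.+1) : i <= j ->
  adjoin (factor_of i j) = iprod (map y (iota i (j.+1 - i))).
Proof.
move=> ij; rewrite adjoin_rmuls.
rewrite (@filter_enum_ord (fun k => i < k <= j) i.+1 j.+1) //; last by have := ltn_ord j; lia.
by rewrite subSS subSn //= iprod_cons /y inord_val.
Qed.

Lemma adjoin_replaced_of (i j : 'I_n.+1) c :
  adjoin (replaced_of i j c) = iprod (map y (iota 0 i)) * adjoin c *
                               iprod (map y (iota j.+1 (n - j))).
Proof.
rewrite adjoin_rmuls adjoin_lmuls.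
rewrite (@filter_enum_ord (fun k => k < i) 0 i) ?subn0 //; last by have := ltn_ord i; lia.
rewrite (@filter_enum_ord (fun k => j < k) j.+1 n.+1) // ?ltn_ord ?leqnn //.
by move=> k; rewrite ltn_ord andbT.
Qed.

End Shapes.

Section ShapeMorphism.
Variables (n : nat) (G H : semigroupType) (f : {multiplicative G -> H}).
Implicit Type x : 'I_n.+1 -> G.

Lemma rmuls_morph (a : G) s : f (rmuls a s) = rmuls (f a) (map f s).
Proof. by elim: s a => //= b s IH a; rewrite IH gmulfM. Qed.

Lemma lmuls_morph s (a : G) : f (lmuls s a) = lmuls (map f s) (f a).
Proof. by elim: s => //= b s IH; rewrite gmulfM IH. Qed.

Lemma prod_of_morph x : f (prod_of x) = prod_of (f \o x).
Proof. by rewrite /prod_of rmuls_morph -map_comp. Qed.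

Lemma factor_of_morph x i j : f (factor_of x i j) = factor_of (f \o x) i j.
Proof. by rewrite /factor_of rmuls_morph -map_comp. Qed.

Lemma replaced_of_morph x i j c :
  f (replaced_of x i j c) = replaced_of (f \o x) i j (f c).
Proof. by rewrite /replaced_of rmuls_morph lmuls_morph -!map_comp. Qed.

End ShapeMorphism.

(** * Consequences of a word identity *)

Section WordOutcome.
Variable n : nat.
Local Notation I := 'I_n.+1.

(* inl (i, j) stands for the omega identity of i and j, inr s for the
   permutation identity of s. *)
Definition outcome := (I * I + 'S_n.+1)%type.

Definition proper_outcome (o : outcome) :=
  match o with inl (i, j) => i <= j | inr s => s != 1 end.

Definition realizes (S : semigroupType) (o : outcome) := forall v : I -> S,
  prod_of v = match o with
    | inl (i, j) =>
        replaced_of v i j (omega (factor_of v i j) * factor_of v i j)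
    | inr s => prod_of (fun i => v (s i))
    end.

Definition word_realizes (w : seq I) (o : outcome) :=
  forall S : semigroupType, finite_set [set: S]%classic ->
    (forall v : I -> S, adjoin (prod_of v) = iprod (map v w)) -> realizes S o.

Lemma omega_rule_realizes i l k w : 0 < l -> n.+1 = i + l + k ->
    omega_rule i l k [seq val a | a <- w] ->
  word_realizes w (inl (inord i, inord (i + l).-1)).
Proof.
move=> l0 nE rule S finS Sw v; apply: (@adjoin_inj S).
set a : I := inord i; set b : I := inord _; set c := factor_of v a b.
have iE : a = i :> nat by rewrite /a inordK //; lia.
have jE : b = (i + l).-1 :> nat by rewrite /b inordK //; lia.
rewrite adjoin_replaced_of adjoin_prod_of.
have -> : iota 0 n.+1 = iota 0 i ++ iota i l ++ iota (i + l) k.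
  by rewrite -iotaD -(iotaD 0) addnA nE.
rewrite !map_cat.
have cE : adjoin c = iprod [seq v (inord m) | m <- iota i l].
  rewrite adjoin_factor_of ?iE ?jE; last by lia.
  by congr (iprod (map _ (iota _ _))); lia.
have Sw' : word_identity S (i + l + k) (map val w).
  move=> v'; rewrite -nE; have := Sw (v' \o val).
  rewrite -map_comp => <-; rewrite adjoin_prod_of; congr iprod.
  by apply/eq_in_map => m; rewrite mem_iota /= => /inordK ->.
rewrite (rule S finS Sw' _ _ _ c (omega c)) ?size_map ?size_iota //; last exact: omegaP.
rewrite iprod_cat iprod_cons mulgA iE jE.
by congr (_ * _ * iprod (map _ (iota _ _))); lia.
Qed.

Lemma word_outcome w : w != enum I ->
  exists o, proper_outcome o /\ word_realizes w o.
Proof.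
move=> w_enum; case: (pselect (exists k, k \notin w)) => [[k kw]|full].
  exists (inl (inord k, inord (k + 1).-1)); split.
    by rewrite /= addn1.
  apply: (@omega_rule_realizes k 1 (n.+1 - k.+1)) => //.
    by have := ltn_ord k; lia.
  by apply: omega_rule_missing => //; rewrite (mem_map val_inj).
have {}full k : k \in w by apply: contraT => kw; case: full; exists k.
have wlt : all (gtn n.+1) (map val w) by apply/allP => _ /mapP[a _ ->] /=.
have wsub : {subset iota 0 n.+1 <= map val w}.
  move=> m; rewrite -val_enum_ord => /mapP[a _ ->].
  by rewrite (mem_map val_inj).
case: (ltnP n.+1 (size w)) => [sizew|sizew].
  have [|i [l [k [l0 nE rule]]]] := omega_rule_exists wlt wsub.
    by rewrite size_map.
  exists (inl (inord i, inord (i + l).-1)); split.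
    by rewrite /= !inordK; lia.
  exact: omega_rule_realizes rule.
(* A word of length at most n + 1 in which all n + 1 letters occur contains each exactly once. *)
have uniqw : uniq w /\ size w = n.+1.
  have := @uniq_min_size _ (enum I) w (enum_uniq _) (fun k _ => full k).
  rewrite size_enum_ord sizew => /(_ isT)[sizeE _].
  split=> //; rewrite (@leq_size_uniq _ (enum I)) ?enum_uniq //.
  by rewrite size_enum_ord.
have [uw sizewE] := uniqw.
have inj_nth : injective (fun i : I => nth ord0 w i).
  by move=> i j /eqP; rewrite nth_uniq ?sizewE // => /eqP/val_inj.
pose s := perm inj_nth.
have wE : w = map s (enum I).
  apply: (@eq_from_nth _ ord0); first by rewrite size_map size_enum_ord.
  move=> i; rewrite sizewE => i_n.
  by rewrite (nth_map ord0) ?size_enum_ord // permE nth_enum_ord.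
exists (inr s); split.
  apply: contra w_enum => /eqP s1; rewrite wE s1; apply/eqP.
  by rewrite -[RHS]map_id; apply: eq_map => i; rewrite perm1.
move=> S _ Sw v; apply: (@adjoin_inj S).
by rewrite Sw wE -map_comp prod_of_enum.
Qed.

End WordOutcome.

HB.instance Definition _ (G : semigroupType) :=
  isMultiplicative.Build G (profinite G) (@pembed G) (@pembedM G).

(** * Compactness and passage to profinite words *)

Section ProfiniteOutcome.
Variable n : nat.
Local Notation I := 'I_n.+1.

Definition word_prod : word I := prod_of (@letter I).

Lemma val_word_prod : val word_prod = enum I.
Proof.
have val_rmuls (u : word I) s : val (rmuls u s) = val u ++ flatten (map val s).
  by elim: s u => [|v s IH] u /=; rewrite ?cats0 // IH /= catA.
rewrite val_rmuls -map_comp (eq_map (g := fun k => [:: k])) // flatten_seq1.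
apply: (inj_map val_inj); rewrite /= val_enum_ord.
have := @filter_iota_range n.+1 1 n.+1 (leqnn _).
rewrite -[in LHS]val_enum_ord filter_map subn1 => iotaE.
rewrite -[iota 0 n.+1]/(0 :: iota 1 n) -[in RHS]iotaE; congr (_ :: map val _).
by apply: eq_filter => k; rewrite /= ltn_ord andbT.
Qed.

Lemma xprod_pembed : xprod n = pembed word_prod.
Proof. by rewrite /word_prod (prod_of_morph (@pembed (word I))). Qed.

(** If each of the finitely many options failed at some congruence, none would be left at a common
    refinement of these congruences. *)
Lemma uniform_choice (G : semigroupType) (O : finType)
    (Q : fcong G -> O -> Prop) :
    (forall (t u : fcong G) o, subrel u t -> Q u o -> Q t o) ->
    (forall t, exists o, Q t o) ->
  exists o, forall t, Q t o.
Proof.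
move=> Qmono Qex; apply: contrapT => noQ.
have /choice[t tP] : forall o, exists t, ~ Q t o.
  by move=> o; apply/existsNP => Qo; apply: noQ; exists o.
have [u ut] := fcong_big_meet (enum O) t; have [o Qo] := Qex u.
by apply: (tP o); apply: Qmono Qo; apply: ut; rewrite mem_enum.
Qed.

(* By compactness one outcome serves for words approximating rho arbitrarily
   well. *)
Lemma profinite_outcome (rho : profinite_word I) : xprod n <> rho ->
  exists o, proper_outcome o /\ forall t, exists w : word I,
    pcoord rho t = \pi_(fquot t) w /\ word_realizes (val w) o.
Proof.
move=> xrho; have [t0 t0P] : exists t, pcoord (xprod n) t <> pcoord rho t.
  by apply/existsNP => eqt; apply: xrho; apply: pcoord_inj.
pose Q (t : fcong (word I)) (o : outcome n) := proper_outcome o /\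
  exists w : word I, pcoord rho t = \pi_(fquot t) w /\ word_realizes (val w) o.
have [||o Qo] := @uniform_choice _ _ Q.
- move=> t u o ut [po [w [rw wo]]]; split=> //; exists w; split=> //.
  exact: (@pcoord_refine _ rho (pembed w) _ _ ut).
(* Refining by [t0], where [rho] differs from the product, forces the approximating word to differ
   from x_0 ... x_n. *)
- move=> t; have [u [ut ut0]] := fcong_meet t t0.
  have rw : pcoord rho u = pcoord (pembed (repr (pcoord rho u))) u.
    by rewrite pcoord_pembed reprK.
  set w := repr _ in rw.
  have [|o [po wo]] := @word_outcome n (val w).
    apply/eqP; rewrite -val_word_prod => /val_inj wE; apply: t0P.
    by rewrite xprod_pembed -wE; apply: pcoord_refine ut0 (esym rw).
  by exists o; split=> //; exists w; split=> //; apply: (pcoord_refine ut rw).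
by exists o; split=> [|t]; [have [] := Qo (fcong_total _) | have [] := Qo t].
Qed.

(** Evaluation in [S] factors through the quotient by [weval_fcong], so a word that agrees with
    [rho] there has the same values in [S] as [rho]. *)
Lemma profinite_realizes (rho : profinite_word I) o (S : semigroupType) :
    finite_set [set: S]%classic ->
    (forall t, exists w : word I,
      pcoord rho t = \pi_(fquot t) w /\ word_realizes (val w) o) ->
  satisfies S (product_identity rho) -> realizes S o.
Proof.
move=> finS /(_ (weval_fcong I finS))[w [rw wo]] Srho; apply: wo => // v.
rewrite -wevalE -(peval_pcoord (finS := finS) v rw).
have /= <- := Srho (peval finS v : {multiplicative _ -> _}) (@continuous_peval _ _ finS v).
congr adjoin; rewrite [RHS](prod_of_morph (peval finS v)).
by congr prod_of; apply/funext => i; rewrite /= peval_letter.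
Qed.

Lemma realizes_omega (S : semigroupType) (i j : I) :
  finite_set [set: S]%classic -> realizes S (inl (i, j)) ->
  satisfies S (omega_identity i j).
Proof.
move=> finS Sij f fc; rewrite /= [LHS](prod_of_morph f) Sij.
rewrite [RHS](replaced_of_morph f) /pomegaS gmulfM continuous_pomega //.
by rewrite [f (xfactor i j)](factor_of_morph f).
Qed.

Lemma realizes_perm (S : semigroupType) (s : 'S_n.+1) :
  realizes S (inr s) -> satisfies S (perm_identity s).
Proof.
move=> Ss f fc; rewrite /= [LHS](prod_of_morph f) Ss.
by rewrite [RHS](prod_of_morph f (fun i => xvar (s i))).
Qed.

End ProfiniteOutcome.

Theorem theoremA (n : nat) (rho : profinite_word 'I_n.+1)
    (rho_nontrivial : xprod n <> rho) :
  [/\ (exists i j : 'I_n.+1, (i <= j)%N /\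
         entails (product_identity rho) (omega_identity i j)) \/
      (exists s : 'S_n.+1, s <> 1%g /\
         entails (product_identity rho) (perm_identity s)),
      forall S : semigroupType, finite_set [set: S]%classic ->
        satisfies S (product_identity rho) ->
        almost_completely_regular S \/ permutative S
    & forall V : semigroupType -> Prop, is_pseudovariety V ->
        class_satisfies V (product_identity rho) ->
        class_almost_completely_regular V \/ class_permutative V].
Proof.
(* The outcome is chosen before any [S], so a single identity serves all members of a
   pseudovariety. *)
have [[[i j]|s] [po rho_o]] := profinite_outcome rho_nontrivial.
- have rho_ij : entails (product_identity rho) (omega_identity i j).
    by move=> S finS /(profinite_realizes finS rho_o); apply: realizes_omega.
  split=> [|S finS Srho|V pV Vrho]; left; [exists i, j | exists n, i, j | exists n, i, j]; split=> //.
    exact: rho_ij.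
  by move=> S VS; apply: rho_ij; [apply: pseudovariety_finite VS | apply: Vrho].
- have rho_s : entails (product_identity rho) (perm_identity s).
    by move=> S finS /(profinite_realizes finS rho_o); apply: realizes_perm.
  move/eqP in po.
  split=> [|S finS Srho|V pV Vrho]; right; [exists s | exists n, s | exists n, s]; split=> //.
    exact: rho_s.
  by move=> S VS; apply: rho_s; [apply: pseudovariety_finite VS | apply: Vrho].
Qed.
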